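(* For every $[f]\in\mathcal{X}$, $$\|[f]\|^{\sharp}_{\infty,h;\varphi}=\sup\Bigl\{\Bigl|\int_A f\,d\nu\Bigr|:\ \nu\in\mathcal{M}_0^{W^{-1}}(A),\ \|\nu\|_{W^{-1}}\le1\Bigr\},$$ but the supremum need not be attained (that is, there exist $A$, $h$, $\varphi$ as in the context and $[f]\in\mathcal{X}$ for which no such $\nu$ attains it).
   Context: $A$ is a non-compact, locally compact, $\sigma$-compact Hausdorff space, assumed second countable; $h:A\to[0,\infty)$ is a fixed continuous proper exhaustion function, i.e. $h$ is continuous and $h^{-1}([0,R])$ is compact for every $R<\infty$. $C(A)$ is the space of real continuous functions on $A$. $\varphi:[0,\infty)\to[1,\infty)$ is admissible: continuous, non-decreasing, $\varphi(0)=1$, and there is $K\ge1$ with $\varphi(r+s)\le K\varphi(r)\varphi(s)$ for all $r,s\ge0$. It is moreover unbounded: $\varphi(t)\to\infty$ as $t\to\infty$. $W:=\varphi\circ h$. $\|[f]\|^{\sharp}_{\infty,h;\varphi}:=\inf_{c\in\mathbb{R}}\sup_{A}W|f-c|$, for $[f]$ the class of $f$ in $C(A)/\mathbb{R}$ (modulo constants). $C^{\sharp}_{h;\varphi}(A)$ is the space of classes for which this is finite. $C^{(h)}_\varphi([f]):=\inf_{c\in\mathbb{R}}\limsup_{h(a)\to\infty}W(a)|f(a)-c|$, and $\mathcal{X}:=\{[f]\in C^{\sharp}_{h;\varphi}(A):C^{(h)}_\varphi([f])=0\}$. $\mathcal{M}_0^{W^{-1}}(A)$ is the space of finite signed regular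 Borel measures $\nu$ on $A$ with $\nu(A)=0$ and $\|\nu\|_{W^{-1}}:=\int_A W^{-1}\,d|\nu|<\infty$. *)

(* Defs.v *)
From HB Require Import structures.
From mathcomp Require Import all_boot all_order all_algebra.
From mathcomp Require Import all_classical all_reals all_analysis.

Set Implicit Arguments.
Unset Strict Implicit.
Unset Printing Implicit Defensive.

Import Order.TTheory GRing.Theory Num.Theory.
Import numFieldNormedType.Exports.

Local Open Scope classical_set_scope.
Local Open Scope ring_scope.

Definition sigma_compact (A : topologicalType) :=
  exists2 K : nat -> set A, (forall n, compact (K n)) & \bigcup_n K n = setT.

Definition base_space (A : topologicalType) :=
  [/\ ~ compact [set: A], locally_compact [set: A], sigma_compact A,
      hausdorff_space A & @second_countable A].

Definition exhaustion (R : realType) (A : topologicalType) (h : A -> R) :=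
  [/\ continuous h, forall a, 0 <= h a &
      forall r : R, compact (h @^-1` `[0, r])].

(* A map [0, +oo[ -> [1, +oo[ is encoded by a total function on R, whose values
   on negative arguments are irrelevant. *)
Definition admissible (R : realType) (phi : R -> R) :=
  [/\ {within `[0, +oo[, continuous phi},
      forall r s, 0 <= r -> r <= s -> phi r <= phi s,
      phi 0 = 1,
      forall r, 0 <= r -> 1 <= phi r &
      exists2 K, 1 <= K &
        forall r s, 0 <= r -> 0 <= s -> phi (r + s) <= K * phi r * phi s].

Definition weight (R : realType) (A : Type) (h : A -> R) (phi : R -> R)
  : A -> R := phi \o h.

(* A class of C(A) / R is handled through an arbitrary representative f;
   sharp_norm_class and tail_const_class below show that the two seminorms do
   not depend on f, and the pairing with nu does not either since nu(A) = 0. *)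
Definition sharp_norm (R : realType) (A : Type) (h : A -> R) (phi : R -> R)
    (f : A -> R) : \bar R :=
  ereal_inf [set ereal_sup [set (weight h phi a * `|f a - c|)%:E | a in setT]
            | c in setT].

(* the filter of neighbourhoods of infinity "h(a) -> +oo" *)
Definition exhaustion_infty (R : realType) (A : Type) (h : A -> R)
  : set_system A := filter_from setT (fun M : R => [set a | M < h a]).

Definition tail_const (R : realType) (A : topologicalType) (h : A -> R)
    (phi : R -> R) (f : A -> R) : \bar R :=
  ereal_inf
    [set limf_esup (fun a => (weight h phi a * `|f a - c|)%:E)
                   (exhaustion_infty h) | c in setT].

Definition sharp_space (R : realType) (A : topologicalType) (h : A -> R)
    (phi : R -> R) : set (A -> R) :=
  [set f | continuous f /\ (sharp_norm h phi f < +oo)%E].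

Definition tail_null_space (R : realType) (A : topologicalType) (h : A -> R)
    (phi : R -> R) : set (A -> R) :=
  [set f | sharp_space h phi f /\ tail_const h phi f = 0%E].

(* The measurable structure of g_sigma_algebraType needs a distinguished point;
   this is no restriction, the spaces at hand being non-empty. *)
Definition borel (A : ptopologicalType) := g_sigma_algebraType (@open A).

(* The library's Jordan decomposition takes a Hahn decomposition as a parameter
   and is independent of it (Hahn_decomposition_uniq); one is chosen here. *)
Section signed_measure.
Context d (T : measurableType d) (R : realType).
Implicit Types nu : {charge set T -> \bar R}.

Definition hahnP nu :=
  projT2 (cid (projT2 (cid (Hahn_decomposition nu)))).

Definition variation nu : {measure set T -> \bar R} :=
  charge_variation (hahnP nu).

Definition charge_integral nu (g : T -> \bar R) : \bar R :=
  (\int[jordan_pos (hahnP nu)]_x g x - \int[jordan_neg (hahnP nu)]_x g x)%E.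

End signed_measure.

Definition regular_measure (R : realType) (A : ptopologicalType)
    (mu : {measure set (borel A) -> \bar R}) :=
  forall E : set (borel A), measurable E ->
    mu E = ereal_inf [set mu U | U in [set U : set A | open U /\ E `<=` U]] /\
    mu E = ereal_sup [set mu K | K in [set K : set A | compact K /\ K `<=` E]].

Definition dual_norm (R : realType) (A : ptopologicalType) (h : A -> R)
    (phi : R -> R) (nu : {charge set (borel A) -> \bar R}) : \bar R :=
  (\int[variation nu]_a ((weight h phi a)^-1)%:E)%E.

(* Finiteness of nu is part of the type of charges. *)
Definition balanced_measures (R : realType) (A : ptopologicalType)
    (h : A -> R) (phi : R -> R) : set ({charge set (borel A) -> \bar R}) :=
  [set nu | [/\ regular_measure (variation nu), nu setT = 0%E &
                (dual_norm h phi nu < +oo)%E]].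

Definition dual_ball (R : realType) (A : ptopologicalType)
    (h : A -> R) (phi : R -> R) : set ({charge set (borel A) -> \bar R}) :=
  [set nu | balanced_measures h phi nu /\ (dual_norm h phi nu <= 1)%E].

Definition pairing (R : realType) (A : ptopologicalType) (f : A -> R)
    (nu : {charge set (borel A) -> \bar R}) : \bar R :=
  charge_integral nu (fun a => (f a)%:E).

Lemma image_shift (R : realType) (F G : R -> \bar R) (k : R) :
  (forall c, F (c + k) = G c) ->
  [set F c | c in setT] = [set G c | c in setT].
Proof.
move=> FG; apply/seteqP; split=> _ [c _ <-].
  by exists (c - k) => //; rewrite -FG subrK.
by exists (c + k) => //; rewrite FG.
Qed.

Lemma sharp_norm_class (R : realType) (A : Type) (h : A -> R) (phi : R -> R)
    (f : A -> R) (k : R) :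
  sharp_norm h phi (fun a => f a + k) = sharp_norm h phi f.
Proof.
rewrite /sharp_norm; congr ereal_inf; apply: (@image_shift _ _ _ k) => c.
congr ereal_sup; apply: eq_imagel => a _.
by rewrite [c + k]addrC opprD addrA addrK.
Qed.

Lemma tail_const_class (R : realType) (A : topologicalType) (h : A -> R)
    (phi : R -> R) (f : A -> R) (k : R) :
  tail_const h phi (fun a => f a + k) = tail_const h phi f.
Proof.
rewrite /tail_const; congr ereal_inf; apply: (@image_shift _ _ _ k) => c.
congr limf_esup; apply/funext => a.
by rewrite [c + k]addrC opprD addrA addrK.
Qed.

(* Main.v *)
(* Since W tends to infinity, a constant c with sup W|f - c| finite is the limit
   of f at infinity. As nu(A) = 0, f may be replaced by f - c in the pairing, so
   |nu(f)| <= sup W|f - c| * int W^-1 d|nu|; conversely, the normalised dipoles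
   delta_a - delta_b, with b going to infinity, have pairings with f tending to
   W(a)(f(a) - c). The supremum is not attained for A = nat, h(n) = n,
   phi(t) = 1 + t and f the indicator of 0: there the sharp norm is 1, and an
   extremal nu would be carried by {0}, hence zero because it is balanced. *)
Require Import Defs.
From HB Require Import structures.
From mathcomp Require Import all_boot all_order all_algebra.
From mathcomp Require Import lra measurable_realfun.
From mathcomp Require Import all_classical all_reals all_analysis.

Set Implicit Arguments.
Unset Strict Implicit.
Unset Printing Implicit Defensive.

Import Order.TTheory GRing.Theory Num.Theory.
Import numFieldNormedType.Exports.

Local Open Scope classical_set_scope.
Local Open Scope ring_scope.

(** Trades an identity between differences for one between sums, which can be read as an equality of
    nonnegative measures. *)
Lemma fin_sube_eq_adde (R : realDomainType) (a b c e : \bar R) :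
  a \is a fin_num -> b \is a fin_num -> c \is a fin_num -> e \is a fin_num ->
  (a - b = c - e <-> a + e = c + b)%E.
Proof.
move: a b c e => [a| |] [b| |] [c| |] [e| |]// _ _ _ _.
by rewrite -!EFinN -!EFinD; split=> -[abce]; congr EFin; lra.
Qed.

(** * Signed measures: Jordan parts, integrals and dipoles *)

Section signed_measure.
Context d (T : measurableType d) (R : realType).
Implicit Types (nu : {charge set T -> \bar R})
  (mu : {finite_measure set T -> \bar R}).

Lemma charge_Jordan nu (E : set T) : measurable E ->
  nu E = (jordan_pos (hahnP nu) E - jordan_neg (hahnP nu) E)%E.
Proof.
move=> mE; rewrite (jordan_decomp (hahnP nu) mE) /cadd/=.
by rewrite cscaleN1.
Qed.

(** The Jordan decomposition is minimal: on [P] the charge is at most [m1], on [N] its opposite is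
    at most [m2], and each Jordan part only sees its own half of [E]. *)
Lemma charge_variation_le nu (m1 m2 : {finite_measure set T -> \bar R})
    (P N : set T) (nuPN : hahn_decomposition nu P N) (E : set T) :
  (forall F, measurable F -> nu F = m1 F - m2 F)%E -> measurable E ->
  (charge_variation nuPN E <= m1 E + m2 E)%E.
Proof.
move=> nuE mE; have [[mP _] [mN _] _ _] := nuPN.
have mEP : measurable (E `&` P) by exact: measurableI.
have mEN : measurable (E `&` N) by exact: measurableI.
rewrite /charge_variation/= leeD//.
- rewrite jordan_posE cjordan_posE /crestr0 mem_set// /crestr nuE//.
  rewrite (@le_trans _ _ (m1 (E `&` P)))//.
    by rewrite leeBlDr ?leeDl// fin_num_measure.
  by apply: le_measure; rewrite ?inE.
- rewrite jordan_negE cjordan_negE /crestr0 mem_set// /crestr nuE//.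
  rewrite fin_num_oppeB ?fin_num_measure// addeC.
  rewrite (@le_trans _ _ (m2 (E `&` N)))//.
    by rewrite leeBlDr ?leeDl// fin_num_measure.
  by apply: le_measure; rewrite ?inE.
Qed.

Lemma bounded_integrable mu (g : T -> R) (M : R) :
  measurable_fun setT g -> (forall x, `|g x| <= M) ->
  mu.-integrable setT (EFin \o g).
Proof.
move=> mg gM.
apply: (@le_integrable _ _ _ mu setT measurableT _ (EFin \o cst M)).
- exact/measurable_EFinP.
- by move=> x _ /=; rewrite lee_fin (le_trans (gM x))// ler_norm.
- exact: finite_measure_integrable_cst.
Qed.

(** Any decomposition into finite measures computes the integral: [p - n = m1 - m2] gives
    [p + m2 = m1 + n] as measures, and integrating the bounded [g] against both sides only involves
    finite terms, which can be moved back. *)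
Lemma charge_integralE nu (m1 m2 : {finite_measure set T -> \bar R})
    (g : T -> R) (M : R) :
  (forall E : set T, measurable E -> nu E = (m1 E - m2 E)%E) ->
  measurable_fun setT g -> (forall x, `|g x| <= M) ->
  charge_integral nu (EFin \o g) =
    (\int[m1]_x (g x)%:E - \int[m2]_x (g x)%:E)%E.
Proof.
move=> nuE mg gM.
pose p : {finite_measure set T -> \bar R} := jordan_pos (hahnP nu).
pose n : {finite_measure set T -> \bar R} := jordan_neg (hahnP nu).
have gI (mu : {finite_measure set T -> \bar R}) :
    mu.-integrable setT (EFin \o g) by exact: bounded_integrable gM.
have mg' : measurable_fun setT (EFin \o g) by exact/measurable_EFinP.
have fin (mu : {finite_measure set T -> \bar R}) :
    (\int[mu]_x (g x)%:E)%E \is a fin_num.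
  exact: (integrable_fin_num measurableT (gI mu)).
have key : (\int[p]_x (g x)%:E + \int[m2]_x (g x)%:E =
    \int[m1]_x (g x)%:E + \int[n]_x (g x)%:E)%E.
  rewrite -!integral_measure_add//; [|exact: gI..].
  apply: eq_measure_integral => E mE _.
  rewrite [LHS]measure_addE [RHS]measure_addE.
  apply/(fin_sube_eq_adde (fin_num_measure p E mE) (fin_num_measure n E mE)
    (fin_num_measure m1 E mE) (fin_num_measure m2 E mE)).
  by rewrite -nuE// charge_Jordan.
rewrite /charge_integral -/p -/n /=.
exact/(fin_sube_eq_adde (fin p) (fin n) (fin m1) (fin m2)).
Qed.

(** Zero total charge makes the Jordan parts equal in mass, so [g] may be replaced by [g - c]. The
    domination by [N * w] is then integrated against each part, and the two parts add up to the
    variation. The bound [M] supplies integrability. *)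
Lemma charge_integral_le nu (g w : T -> R) (c M N : R) :
  nu setT = 0%E -> measurable_fun setT g -> measurable_fun setT w ->
  (forall x, `|g x - c| <= M) -> 0 <= N -> (forall x, 0 <= w x) ->
  (forall x, `|g x - c| <= N * w x) ->
  (`|charge_integral nu (EFin \o g)| <=
    N%:E * \int[Defs.variation nu]_x (w x)%:E)%E.
Proof.
move=> nu0 mg mw gM N0 w0 gw.
pose p : {finite_measure set T -> \bar R} := jordan_pos (hahnP nu).
pose n : {finite_measure set T -> \bar R} := jordan_neg (hahnP nu).
have mgc : measurable_fun setT (fun x => g x - c) by exact: measurable_funB.
have gcI (mu : {finite_measure set T -> \bar R}) :
    mu.-integrable setT (fun x => (g x - c)%:E).
  exact: (@bounded_integrable _ _ M).
have intE (mu : {finite_measure set T -> \bar R}) :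
    (\int[mu]_x (g x)%:E = \int[mu]_x (g x - c)%:E + c%:E * mu setT)%E.
  rewrite -[X in (_ + X)%E]integral_cst// -integralD//;
    [|exact: gcI|exact: finite_measure_integrable_cst].
  by apply: eq_integral => x _; rewrite /= -EFinD subrK.
have fin (mu : {finite_measure set T -> \bar R}) :
    (\int[mu]_x (g x - c)%:E)%E \is a fin_num.
  exact: (integrable_fin_num measurableT (gcI mu)).
have pn : p setT = n setT.
  rewrite -[LHS]adde0 -[RHS]add0e.
  apply/fin_sube_eq_adde => //; [exact: fin_num_measure..|].
  by rewrite sube0 -nu0 charge_Jordan.
have cpf : (c%:E * n setT)%E \is a fin_num.
  by rewrite fin_numM// fin_num_measure.
have -> : charge_integral nu (EFin \o g) =
    (\int[p]_x (g x - c)%:E - \int[n]_x (g x - c)%:E)%E.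
  rewrite /charge_integral -/p -/n /= !intE pn.
  (* All terms are finite, so the common contribution of the constant [c] cancels. *)
  move: (fin p) (fin n) cpf.
  move: (\int[p]_x _)%E (\int[n]_x _)%E (c%:E * _)%E.
  move=> [a| |] [b| |] [e| |]// _ _ _.
  by rewrite -?EFinN -!EFinD; congr EFin; lra.
have bnd (mu : {finite_measure set T -> \bar R}) :
    (`|\int[mu]_x (g x - c)%:E| <= N%:E * \int[mu]_x (w x)%:E)%E.
  rewrite (le_trans (le_abse_integral _ _ _))//; first exact/measurable_EFinP.
  rewrite -ge0_integralZl_EFin//; last 2 first.
    by move=> x _; rewrite lee_fin.
    exact/measurable_EFinP.
  apply: ge0_le_integral => //.
  - by apply: measurableT_comp => //; exact/measurable_EFinP.
  - by apply/measurable_EFinP; exact: measurable_funM.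
  - by move=> x _; rewrite lee_fin.
have -> : (\int[Defs.variation nu]_x (w x)%:E =
    \int[p]_x (w x)%:E + \int[n]_x (w x)%:E)%E.
  rewrite -ge0_integral_measure_add//; last 2 first.
    by move=> x _; rewrite lee_fin.
    exact/measurable_EFinP.
  by apply: eq_measure_integral => E mE _; rewrite [RHS]measure_addE.
rewrite ge0_muleDr ?integral_ge0//; last 2 first.
  by move=> x _; rewrite lee_fin.
  by move=> x _; rewrite lee_fin.
by rewrite (le_trans (lee_abs_sub _ _))// leeD.
Qed.

Lemma integral_scaled_dirac (k : {nonneg R}) (a : T) (g : T -> R) :
  measurable_fun setT g ->
  (\int[mscale k (dirac a)]_x (g x)%:E = (k%:num * g a)%:E)%E.
Proof.
move=> mg; have mg' : measurable_fun setT (EFin \o g) by exact/measurable_EFinP.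
rewrite integralE !ge0_integral_mscale//; last 2 first.
  exact: measurable_funeneg.
  exact: measurable_funepos.
rewrite !integral_dirac//; last 2 first.
  exact: measurable_funeneg.
  exact: measurable_funepos.
(* What remains is the splitting of the real number [g a] into its positive and negative parts. *)
rewrite diracT !mul1e !funeposE !funenegE /= -EFin_max.
rewrite -?EFin_max -!EFinM -EFinB -mulrBr; congr (_ * _)%:E.
have [ga|/ltW ga] := lerP 0 (g a).
  by rewrite max_r ?subr0// oppr_le0.
by rewrite max_l ?sub0r ?opprK// oppr_ge0.
Qed.

Lemma mscale_diracE (k : {nonneg R}) (a : T) (E : set T) :
  mscale k (dirac a) E = (k%:num * (a \in E)%:R)%:E.
Proof. by rewrite /mscale /= /dirac indicE. Qed.

(** The test measures for the lower bound. Assembling them from operations on charges lets the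
    charge structure be inferred; [a = b] is allowed and gives the zero charge. *)
Definition dipole (t : {nonneg R}) (a b : T) : set T -> \bar R :=
  cadd (charge_of_finite_measure (mscale t (dirac a)))
       (copp (charge_of_finite_measure (mscale t (dirac b)))).

HB.instance Definition _ t a b := Charge.on (dipole t a b).

Lemma dipoleE (t : {nonneg R}) (a b : T) E :
  dipole t a b E = (mscale t (dirac a) E - mscale t (dirac b) E)%E.
Proof. by []. Qed.

End signed_measure.

(** * Borel measurability and regularity *)

Section borel_measures.
Context (R : realType) (A : ptopologicalType).

Lemma open_borel (U : set A) : open U -> measurable (U : set (borel A)).
Proof. exact: sub_sigma_algebra. Qed.

Lemma closed_borel (F : set A) : closed F -> measurable (F : set (borel A)).
Proof.
move=> cF; rewrite -[F]setCK; apply: measurableC; apply: open_borel.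
exact: closed_openC.
Qed.

Lemma continuous_borel (f : A -> R) :
  continuous f -> measurable_fun setT (f : borel A -> R).
Proof.
move=> /continuousP cf; apply: (measurability _ (RGenOpens.measurableE R)).
move=> _ [_ [a [b ->] <-]]; rewrite setTI; apply: open_borel.
by apply: cf; exact: interval_open.
Qed.

(** Up to a null set, [E] is its trace on the finite set [S]. That trace is compact, which gives
    inner regularity; removing the closed set [S \ E] from the space gives an open superset of [E]
    with the same trace. *)
Lemma concentrated_regular (mu : {measure set (borel A) -> \bar R})
    (S : set A) :
  hausdorff_space A -> finite_set S -> mu (~` S) = 0%E -> regular_measure mu.
Proof.
move=> hA fS muS E mE.
have /accessible_finite_set_closed closed_fin := hausdorff_accessible hA.
have mS : measurable (S : set (borel A)).
  by apply: closed_borel; exact: closed_fin.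
have muI (F : set (borel A)) : measurable F -> mu F = mu (F `&` S).
  move=> mF; rewrite (measureDI mu mF mS).
  rewrite [X in (X + _)%E](_ : _ = 0%E) ?add0e//.
  apply: (subset_measure0 _ _ _ muS) => //.
  - exact: measurableD.
  - exact: measurableC.
split; apply/eqP; rewrite eq_le; apply/andP; split.
- apply: le_ereal_inf_tmp => _ [U [oU EU] <-].
  by apply: le_measure; rewrite ?inE//; exact: open_borel.
- have oU : open (~` (S `\` E)).
    by apply: closed_openC; apply: closed_fin; exact: finite_setD.
  apply: (@le_trans _ _ (mu (~` (S `\` E)))).
    apply: ereal_inf_lbound; exists (~` (S `\` E)) => //.
    by split => // x Ex [_]; exact.
  rewrite muI; last exact: open_borel.
  rewrite [leRHS]muI// le_measure ?inE//.
  + by apply: measurableI => //; exact: open_borel.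
  + exact: measurableI.
  + by move=> x [nSE Sx]; split => //; apply: contrapT => nE; apply: nSE.
- have fES : finite_set (E `&` S) by exact: finite_setIr.
  rewrite muI//; apply: ereal_sup_ubound.
  by exists (E `&` S) => //; split; [exact: finite_compact|exact: subIsetl].
- apply: ge_ereal_sup => _ [K [cK KE] <-].
  apply: le_measure; rewrite ?inE//.
  by apply: closed_borel; exact: compact_closed.
Qed.

End borel_measures.

(** * Measurability and growth of the weight *)

Section weight.
Context (R : realType) (A : ptopologicalType) (h : A -> R) (phi : R -> R).
Local Notation W := (weight h phi).

Lemma weight_ge1 : exhaustion h -> admissible phi -> forall a, 1 <= W a.
Proof. by move=> [_ h0 _] [_ _ _ phi1 _] a; exact: phi1. Qed.

Lemma measurable_weight : exhaustion h -> admissible phi ->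
  measurable_fun setT (W : borel A -> R).
Proof.
move=> [ch h0 _] [cphi _ _ _ _].
(* Continuity of [phi] is only known on the half-line, so the composition passes through that
   set. *)
apply: (@measurable_comp _ _ _ _ _ _ (`[0, +oo[%classic : set R)).
- exact: measurable_itv.
- by move=> _ [a _ <-] /=; rewrite in_itv/= h0.
- exact: subspace_continuous_measurable_fun.
- exact: continuous_borel.
Qed.

(** An upper bound [r] for [h] would make the whole space equal to the compact set where [h] lies in
    [[0, r]]. *)
Lemma exhaustion_unbounded : ~ compact [set: A] -> exhaustion h ->
  forall r, exists a, r < h a.
Proof.
move=> ncA [_ h0 hc] r; apply: contrapT => /forallNP nr; apply: ncA.
rewrite (_ : setT = h @^-1` `[0, r])//; apply/seteqP; split => // a _ /=.
by rewrite in_itv/= h0/= leNgt; apply/negP.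
Qed.

Lemma weight_unbounded : ~ compact [set: A] -> exhaustion h ->
  phi t @[t --> +oo] --> +oo -> forall r, exists a, r < W a.
Proof.
move=> ncA he /cvgryPgt phioo r.
have [M [_ MP]] := phioo r.
by have [a Ma] := exhaustion_unbounded ncA he M; exists a; exact: MP.
Qed.

End weight.

(** * The duality formula *)

Section duality.
Context (R : realType) (A : ptopologicalType) (h : A -> R) (phi : R -> R).
Hypotheses (bA : base_space A) (hh : exhaustion h) (phiP : admissible phi).
Hypothesis phioo : phi t @[t --> +oo] --> +oo.
Variable f : A -> R.
Hypothesis cf : continuous f.
Local Notation W := (weight h phi).

Let W_gt0 a : 0 < W a.
Proof. exact: lt_le_trans (weight_ge1 hh phiP a). Qed.

Let measurable_weightV :
  measurable_fun setT ((fun a => (W a)^-1) : borel A -> R).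
Proof.
(* Inversion is continuous away from 0, and the weight takes positive values. *)
apply: (@measurable_comp _ _ _ _ _ _ (`]0, +oo[%classic : set R)).
- exact: measurable_itv.
- by move=> _ [a _ <-] /=; rewrite in_itv/= W_gt0.
- apply: open_continuous_measurable_fun; first exact: interval_open.
  move=> x; rewrite inE/= in_itv/= andbT => x0.
  by apply: inv_continuous; rewrite gt_eqF.
- exact: measurable_weight.
Qed.

(** As the weight is at least 1, a weighted bound is also a uniform one; this makes [f] integrable
    for finite measures. *)
Let weighted_bound c N : (forall a, W a * `|f a - c| <= N) ->
  forall a, `|f a - c| <= N.
Proof.
move=> fN a; apply: le_trans (fN a).
by rewrite ler_peMl// weight_ge1.
Qed.

Lemma pairing_le c N (nu : {charge set (borel A) -> \bar R}) :
  (forall a, W a * `|f a - c| <= N) -> dual_ball h phi nu ->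
  (`|pairing f nu| <= N%:E)%E.
Proof.
move=> fN [[_ nu0 _] nu1].
have N0 : 0 <= N by apply: le_trans (weighted_bound fN point).
apply: (@le_trans _ _ (N%:E * dual_norm h phi nu)%E).
  apply: (charge_integral_le (c := c) (M := N) nu0) => //.
  - exact: continuous_borel.
  - exact: weighted_bound.
  - by move=> a; rewrite invr_ge0 ltW.
  - by move=> a; rewrite ler_pdivlMr// mulrC.
by rewrite -[leRHS]mule1 lee_wpmul2l// lee_fin.
Qed.

(** The variation is dominated by the sum of the two scaled Dirac masses. This bounds the norm and
    confines the variation to [{a, b}], hence regularity; using only the inequality avoids treating
    [a = b] separately. *)
Lemma dipole_dual_ball (t : {nonneg R}) (a b : borel A) :
  t%:num * ((W a)^-1 + (W b)^-1) <= 1 -> dual_ball h phi (dipole t a b).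
Proof.
move=> t1; have [_ _ _ hA _] := bA.
have vle (E : set (borel A)) : measurable E ->
    (Defs.variation (dipole t a b) E <=
     mscale t (dirac a) E + mscale t (dirac b) E)%E.
  exact: charge_variation_le.
have norm1 : (dual_norm h phi (dipole t a b) <= 1)%E.
  apply: (@le_trans _ _ (\int[measure_add (mscale t (dirac a))
      (mscale t (dirac b))]_x ((W x)^-1)%:E)%E).
    apply: ge0_le_measure_integral => //.
    + by move=> E mE; rewrite [leRHS]measure_addE; exact: vle.
    + by move=> x; rewrite lee_fin invr_ge0 ltW.
    + exact/measurable_EFinP.
  rewrite ge0_integral_measure_add//; last 2 first.
    by move=> x _; rewrite lee_fin invr_ge0 ltW.
    exact/measurable_EFinP.
  by rewrite !integral_scaled_dirac// -EFinD -mulrDr lee_fin.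
split=> //; split.
- apply: (concentrated_regular (S := [set a; b])) => //.
  have mS : measurable (~` [set a; b] : set (borel A)).
    apply: measurableC; apply: closed_borel.
    by have /accessible_finite_set_closed := hausdorff_accessible hA; apply.
  apply/eqP; rewrite eq_le measure_ge0 andbT (le_trans (vle _ mS))//.
  rewrite !mscale_diracE !memNset ?mulr0 ?adde0//.
  + by apply; right.
  + by apply; left.
- by rewrite [LHS]dipoleE !mscale_diracE !in_setT subee.
- by rewrite (le_lt_trans norm1)// ltry.
Qed.

Lemma pairing_dipole c N (t : {nonneg R}) (a b : borel A) :
  (forall x, W x * `|f x - c| <= N) ->
  pairing f (dipole t a b) = (t%:num * (f a - f b))%:E.
Proof.
move=> fN.
have fb x : `|f x| <= N + `|c|.
  rewrite -[f x](subrK c) (le_trans (ler_normD _ _))// lerD2r.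
  exact: weighted_bound.
rewrite /pairing (@charge_integralE _ _ _ _ (mscale t (dirac a))
  (mscale t (dirac b)) f (N + `|c|))//; last exact: continuous_borel.
by rewrite !integral_scaled_dirac ?mulrBr//; exact: continuous_borel.
Qed.

(** The dipoles give [|f a - f b| <= S * (1 / W a + 1 / W b)], and the weighted bound gives
    [|f b - c| <= N / W b]. As [W b] grows, only [|f a - c| <= S / W a] is left. *)
Lemma weighted_le_sup_pairing c N a : (forall x, W x * `|f x - c| <= N) ->
  ((W a * `|f a - c|)%:E <=
    ereal_sup [set `|pairing f nu|%E | nu in dual_ball h phi])%E.
Proof.
move=> fN; set S := ereal_sup _.
have SP b : ((((W a)^-1 + (W b)^-1)^-1 * `|f a - f b|)%:E <= S)%E.
  (* This mass brings the bound on the norm of the dipole to exactly 1. *)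
  have t0 : 0 <= ((W a)^-1 + (W b)^-1)^-1.
    by rewrite invr_ge0 addr_ge0// invr_ge0 ltW.
  apply: ereal_sup_ubound.
  exists (dipole (NngNum t0) (a : borel A) (b : borel A)).
    apply: dipole_dual_ball => /=; rewrite mulVf//.
    by rewrite gt_eqF// addr_gt0 ?invr_gt0.
  by rewrite (pairing_dipole _ _ _ fN)/= normrM (ger0_norm t0).
have S0 : (0 <= S)%E.
  apply: le_trans (SP a); rewrite lee_fin mulr_ge0// invr_ge0.
  by rewrite addr_ge0// invr_ge0 ltW.
move: S S0 SP => [s| |]// s0 SP; last by rewrite leey.
rewrite lee_fin mulrC -ler_pdivlMr//; apply/ler_addgt0Pr => e e0.
have N0 : 0 <= N by apply: le_trans (weighted_bound fN point).
rewrite lee_fin in s0.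
have sN0 : 0 < s + N + 1 by rewrite ltr_wpDl// addr_ge0.
have [ncA _ _ _ _] := bA.
(* With [W b] this large, the two error terms [s / W b] and [N / W b] add up to at most [e]. *)
have [b Wb] := weight_unbounded ncA hh phioo ((s + N + 1) / e).
have {}SP : `|f a - f b| <= s * (W a)^-1 + s * (W b)^-1.
  rewrite -mulrDr; have := SP b; rewrite lee_fin mulrC ler_pdivrMr//.
  by rewrite addr_gt0// invr_gt0.
have fbc : `|f b - c| <= N * (W b)^-1 by rewrite ler_pdivlMr// mulrC.
have Wbe : (s + N) * (W b)^-1 <= e.
  rewrite ler_pdivrMr// -ler_pdivrMl// mulrC (le_trans _ (ltW Wb))//.
  by rewrite ler_pM2r ?invr_gt0// lerDl.
have := ler_distD (f b) (f a) c; lra.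
Qed.

Lemma sharp_norm_sup_pairing : (sharp_norm h phi f < +oo)%E ->
  sharp_norm h phi f =
    ereal_sup [set `|pairing f nu|%E | nu in dual_ball h phi].
Proof.
move=> foo; apply/eqP; rewrite eq_le; apply/andP; split.
(* Finiteness of the infimum yields one constant with a finite weighted supremum; bounding that
   supremum suffices, since it dominates the norm. *)
- have [_ [c _ <-] coo] : exists2 y, [set ereal_sup [set (W a * `|f a - c|)%:E
      | a in setT] | c in setT] y & (y < +oo)%E by exact/ereal_inf_lt.
  pose N := fine (ereal_sup [set (W a * `|f a - c|)%:E | a in setT]).
  have fN a : W a * `|f a - c| <= N.
    have ub : ((W a * `|f a - c|)%:E <=
        ereal_sup [set (W a * `|f a - c|)%:E | a in setT])%E.
      by apply: ereal_sup_ubound; exists a.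
    rewrite -lee_fin /N fineK// fin_numElt coo andbT.
    by rewrite (lt_le_trans _ ub)// ltNyr.
  apply: (@le_trans _ _ (ereal_sup [set (W a * `|f a - c|)%:E | a in setT])).
    by apply: ereal_inf_lbound; exists c.
  by apply: ge_ereal_sup => _ [a _ <-]; exact: weighted_le_sup_pairing fN.
- apply: le_ereal_inf_tmp => _ [c _ <-]; apply: ge_ereal_sup => _ [nu nuB <-].
  set S := ereal_sup _.
  have Sub a : ((W a * `|f a - c|)%:E <= S)%E.
    by apply: ereal_sup_ubound; exists a.
  (* An infinite supremum bounds everything, and the value at [point] excludes minus infinity. *)
  move: S Sub => [s| |] Sub; last 2 first.
  + by rewrite leey.
  + by have := Sub point; rewrite leeNy_eq.
  by apply: (pairing_le (c := c)) => // a; rewrite -lee_fin.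
Qed.

End duality.

(** * A class on the natural numbers without extremal measure *)

Lemma discrete_continuous (X : discreteTopologicalType) (Y : topologicalType)
  (g : X -> Y) : continuous g.
Proof. by apply/continuousP => U _; exact: discrete_open. Qed.

Section nat_example.
Variable R : realType.
Let h (n : nat) : R := n%:R.
Let phi (t : R) : R := 1 + t.
Let f (n : nat) : R := (n == 0)%:R.

Lemma nat_noncompact : ~ compact [set: nat].
Proof.
move=> cN; have : compact (h @` setT).
  apply: continuous_compact => //.
  exact/continuous_subspaceT/discrete_continuous.
(* Every number above [M] bounds the image; [M + 1] is one, and the Archimedean property contradicts
   it. *)
move=> /compact_bounded[M [_ /(_ (M + 1))]]; rewrite ltrDl ltr01 => /(_ isT) hM.
have /= := hM (h (Num.bound `|M + 1|)) (imageP h I).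
rewrite ger0_norm ?ler0n// leNgt; apply/negP/negPn.
exact: le_lt_trans (ler_norm _) (archi_boundP (normr_ge0 _)).
Qed.

Lemma base_space_nat : base_space nat.
Proof.
split.
- exact: nat_noncompact.
- move=> n _; rewrite withinET; exists [set n].
  + exact: discrete_set1.
  + by split; [exact: finite_compact|exact: discrete_closed].
- exists (fun n => [set n]); first by move=> n; exact: finite_compact.
  by apply/seteqP; split => // n _; exists n.
- exact: discrete_hausdorff.
- exists (range (fun n : nat => [set n])); first exact: card_image_le.
  split; first by move=> _ [n _ <-]; exact: discrete_open.
  move=> n U /nbhs_singleton Un; exists [set n].
    by split=> //; exists n.
  by move=> _ ->.
Qed.

Lemma exhaustion_nat : exhaustion h.
Proof.
split=> [|//|r]; first exact: discrete_continuous.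
apply: finite_compact; apply: (@sub_finite_set _ _ `I_(Num.bound `|r|)).
  move=> n /=; rewrite in_itv/= => /andP[_ nr].
  rewrite -(ltr_nat R) (le_lt_trans nr)//.
  exact: le_lt_trans (ler_norm _) (archi_boundP (normr_ge0 _)).
exact: finite_II.
Qed.

Lemma admissible_affine : admissible phi.
Proof.
split.
- apply: continuous_subspaceT => x; apply: cvgD; [exact: cvg_cst|exact: cvg_id].
- by move=> r s _ rs; rewrite lerD2l.
- by rewrite /phi addr0.
- by move=> r r0; rewrite lerDl.
(* [(1 + r) * (1 + s)] exceeds [1 + (r + s)] by [r * s]. *)
- exists 1 => // r s r0 s0; rewrite /phi; nra.
Qed.

Lemma affine_cvg_pinfty : phi t @[t --> +oo] --> +oo.
Proof.
apply/cvgryPgt => M; exists (M - 1); split; first exact: num_real.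
by move=> t; rewrite ltrBlDl.
Qed.

Lemma weighted_indicator0 n : weight h phi n * `|f n - 0| = f n.
Proof.
rewrite /weight/= /phi /h /f subr0; case: n => [|n] /=.
  by rewrite addr0 normr1 mulr1.
by rewrite normr0 mulr0.
Qed.

Let f_le1 n : f n <= 1.
Proof. by rewrite /f; case: eqP. Qed.

Lemma tail_null_space_nat : tail_null_space h phi f.
Proof.
split.
- split; first exact: discrete_continuous.
  apply: (@le_lt_trans _ _ 1%E); last exact: ltry.
  apply: (@le_trans _ _ (ereal_sup [set (weight h phi a * `|f a - 0|)%:E
      | a in setT])).
    by apply: ereal_inf_lbound; exists 0.
  apply: ge_ereal_sup => _ [n _ <-].
  by rewrite weighted_indicator0 lee_fin f_le1.
apply/eqP; rewrite eq_le; apply/andP; split.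
- apply: (@le_trans _ _ (limf_esup (fun a => (weight h phi a * `|f a - 0|)%:E)
      (exhaustion_infty h))).
    by apply: ereal_inf_lbound; exists 0.
  apply: (@le_trans _ _ (ereal_sup [set (weight h phi a * `|f a - 0|)%:E |
      a in [set n | 0 < h n]])).
    (* The threshold 0 already removes the only point where [f] is nonzero. *)
    by apply: ereal_inf_lbound; exists [set n | 0 < h n] => //; exists 0.
  apply: ge_ereal_sup => _ [n /= n0 <-]; rewrite weighted_indicator0 lee_fin /f.
  by case: n n0 => [|//]; rewrite /h ltxx.
- apply: le_ereal_inf_tmp => _ [c _ <-]; apply: limf_esup_ge0.
    (* The filter at infinity is proper because [h] is unbounded, so the upper limit of a
       nonnegative function is nonnegative. *)
    move=> [M _ M0].
    have [n Mn] := exhaustion_unbounded nat_noncompact exhaustion_nat M.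
    exact: (M0 n).
  move=> n; rewrite lee_fin mulr_ge0//.
  by rewrite (le_trans ler01)// (weight_ge1 exhaustion_nat admissible_affine).
Qed.

Lemma pairing_nat (nu : {charge set (borel nat) -> \bar R}) :
  pairing f nu = nu [set 0%N].
Proof.
have m0 : measurable ([set 0%N] : set (borel nat)).
  by apply: closed_borel; exact: discrete_closed.
rewrite charge_Jordan// /pairing /charge_integral.
have -> : (fun n : borel nat => (f n)%:E) =
    (fun n : borel nat => (\1_[set 0%N] n)%:E : \bar R).
  by apply/funext => n; rewrite indicE /f in_set1.
by rewrite !integral_indic// !setIT.
Qed.

(** A pairing of size 1 puts variation at least 1 on [{0}], where the weight is 1, exhausting the
    norm budget. Nothing is left for the complement [C], so [nu] vanishes there and, being balanced,
    also at 0. *)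
Lemma pairing_nat_not_ge1 (nu : {charge set (borel nat) -> \bar R}) :
  dual_ball h phi nu -> ~ (1 <= `|pairing f nu|)%E.
Proof.
move=> [[_ nu0 _] nu1]; rewrite pairing_nat => ge1.
have mA (E : set nat) : measurable (E : set (borel nat)).
  by apply: open_borel; exact: discrete_open.
pose v := Defs.variation nu.
have v0 : (1 <= v [set 0%N])%E.
  by rewrite (le_trans ge1)//; exact: abse_charge_variation.
have mw : measurable_fun setT (fun n : borel nat => ((weight h phi n)^-1)%:E).
  by move=> _ Y _; exact: mA.
have w_gt0 n : 0 < weight h phi n.
  rewrite (lt_le_trans ltr01)//.
  exact: weight_ge1 exhaustion_nat admissible_affine n.
pose C : set (borel nat) := ~` [set 0%N].
have UC : [set 0%N] `|` C = setT by exact: setUv.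
have w_ge0 n : (0 <= ((weight h phi n)^-1)%:E)%E.
  by rewrite lee_fin invr_ge0 ltW.
have intC : (\int[v]_(n in C) ((weight h phi n)^-1)%:E = 0)%E.
  apply/eqP; rewrite eq_le integral_ge0// andbT.
  (* Adding 1 to both sides lets the share of [{0}], at least 1, be compared with the total norm, at
     most 1. *)
  rewrite -(@leeD2lE _ 1%E)// adde0; apply: le_trans nu1.
  rewrite /dual_norm -/v -UC ge0_integral_setU//; last first.
    by apply/disj_setPS => n [/= -> /(_ erefl)].
  rewrite leeD2r// (eq_integral (cst 1%E)); last first.
    by move=> n; rewrite inE/= => ->; rewrite /weight/= /phi /h addr0 invr1.
  by rewrite integral_cst// mul1e.
have vC : v C = 0%E.
  (* A strictly positive function with zero integral over [C] forces [C] to be null. *)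
  have : (\int[v]_(n in C) `|((weight h phi n)^-1)%:E| = 0)%E.
    by rewrite -[RHS]intC; apply: eq_integral => n _; rewrite gee0_abs.
  move=> /ae_eq_integral_abs[//||N [mN vN CN]].
    exact: measurable_funTS.
  apply: (subset_measure0 _ _ _ vN) => // n Cn; apply: CN => /(_ Cn)[/eqP].
  by rewrite invr_eq0 gt_eqF.
have nuC : nu C = 0%E.
  apply/eqP; rewrite -abse_eq0 eq_le abse_ge0 andbT -vC.
  exact: abse_charge_variation.
have nu00 : nu [set 0%N] = 0%E.
  have := chargeU nu (mA [set 0%N]) (mA C) (setICr _).
  by rewrite UC nu0 nuC adde0 => <-.
by move: ge1; rewrite nu00 abse0 leNgt lte01.
Qed.

End nat_example.

Theorem corollary5p4 (R : realType) :
  (forall (A : ptopologicalType) (h : A -> R) (phi : R -> R),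
     base_space A -> exhaustion h -> admissible phi ->
     phi t @[t --> +oo] --> +oo ->
     forall f : A -> R, tail_null_space h phi f ->
       sharp_norm h phi f =
       ereal_sup [set `|pairing f nu|%E | nu in dual_ball h phi])
  /\
  (exists (A : ptopologicalType) (h : A -> R) (phi : R -> R),
     [/\ base_space A, exhaustion h, admissible phi,
         phi t @[t --> +oo] --> +oo &
         exists2 f : A -> R, tail_null_space h phi f &
           ~ exists2 nu, dual_ball h phi nu &
               `|pairing f nu|%E =
               ereal_sup [set `|pairing f mu|%E | mu in dual_ball h phi]]).
Proof.
split=> [A h phi bA hh phiP phioo f [[cf foo] _]|].
  exact: sharp_norm_sup_pairing.
exists nat, (fun n => n%:R), (fun t => 1 + t); split.
- exact: base_space_nat.
- exact: exhaustion_nat.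
- exact: admissible_affine.
- exact: affine_cvg_pinfty.
exists (fun n => (n == 0)%:R); first exact: tail_null_space_nat.
move=> [nu nuB nuE]; apply: (pairing_nat_not_ge1 nuB); rewrite nuE.
(* At the point 0, with [c = 0], the weighted value is 1, so an attaining measure would have a
   pairing of size at least 1. *)
have := weighted_le_sup_pairing (base_space_nat R) (exhaustion_nat R)
  (admissible_affine R) (@affine_cvg_pinfty R)
  (@discrete_continuous nat R (fun n => (n == 0)%:R)) (c := 0) (N := 1) 0%N.
rewrite /weight/= subr0 normr1 mulr1 addr0; apply => n.
by rewrite weighted_indicator0; case: eqP.
Qed.
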